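(* Let $E$ and $F$ be Banach spaces, let $L\subset E$ be a closed infinite-codimensional subspace, let $T:E\to F$ be a bounded linear operator with the Kato property for $L$, and let $R\in\mathcal R_d(E)$ be such that $R\cap L=\{0\}$. If $(E/L)^*$ is weak$^*$-separable, then there exists a closed subspace $E_1\subset E$ such that (a) $L\subset E_1$; (b) $E/E_1$ is separable and infinite-dimensional; (c) $E_1\cap R=\{0\}$; and (d) $\overline{T(E_1)}=\overline{T(E)}$.
   Context: All spaces are real. For a closed subspace $L$ of $E$, $Q_L:E\to E/L$ is the canonical quotient map. A bounded linear operator $T:E\to F$ has the Kato property for a closed infinite-codimensional subspace $L\subset E$ if for every closed finite-codimensional subspace $W\subset E$ with $L\subset W$ and every $\varepsilon>0$ there exists $u\in W\setminus L$ such that $\|T(u)\|\le \varepsilon\|Q_L(u)\|$. A linear subspace $R\subset E$ is an operator range in $E$ if there exist a Banach space $G$ and a bounded linear operator $A:G\to E$ with $A(G)=R$. $\mathcal R_d(E)$ denotes the class of proper (i.e. $\neq E$) dense operator ranges in $E$. *)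

(* Defs.v *)
From HB Require Import structures.
From mathcomp Require Import all_boot all_order all_algebra.
From mathcomp Require Import generic_quotient ring_quotient.
From mathcomp Require Import all_classical all_reals all_analysis.

Set Implicit Arguments.
Unset Strict Implicit.
Unset Printing Implicit Defensive.

Import Order.TTheory GRing.Theory Num.Theory.
Import numFieldNormedType.Exports.

Local Open Scope classical_set_scope.
Local Open Scope ring_scope.
Local Open Scope quotient_scope.

Record closedSubspace (R : realType) (E : normedModType R) := ClosedSubspace {
  subspace_set :> set E ;
  subspace_submod : submod_closed (mem subspace_set) ;
  subspace_closed : closed subspace_set }.

Definition subspace_pred (R : realType) (E : normedModType R)
  (L : closedSubspace E) : pred E := mem (L : set E).

HB.instance Definition _ (R : realType) (E : normedModType R)
    (L : closedSubspace E) :=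
  GRing.isSubmodClosed.Build R E (subspace_pred L)
    (GRing.submod_closed_semi (subspace_submod L)).

Definition quotient_space (R : realType) (E : normedModType R)
  (L : closedSubspace E) : Type :=
  Quotient.quot (GRing.ZmodClosed.clone E (subspace_pred L) _).

Section QuotientSpace.
Variables (R : realType) (E : normedModType R) (L : closedSubspace E).
Local Notation Q := (quotient_space L).

HB.instance Definition _ := GRing.Zmodule.on Q.
HB.instance Definition _ := EqQuotient.on Q.

Definition quotient_map (x : E) : Q := \pi_Q x.

Lemma quotient_map_eq (x y : E) :
  (quotient_map x = quotient_map y) <-> subspace_set L (x - y).
Proof.
have -> : (quotient_map x = quotient_map y) <-> (x - y \in subspace_pred L).
  by rewrite (Quotient.idealrBE (GRing.ZmodClosed.clone E (subspace_pred L) _));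
    split=> [/eqP|/eqP].
by split=> [/set_mem|/mem_set].
Qed.

Lemma quotient_map_surj (q : Q) : exists x, quotient_map x = q.
Proof. by exists (repr q); rewrite /quotient_map reprK. Qed.

Lemma quotient_mapD (x y : E) :
  quotient_map (x + y) = quotient_map x + quotient_map y.
Proof.
exact: (@Quotient.pi_add _ (GRing.ZmodClosed.clone E (subspace_pred L) _)).
Qed.

Lemma quotient_map0 : quotient_map 0 = 0.
Proof. by have := raddf0 (\pi_(quotient_space L)). Qed.

Definition quotient_scale (a : R) (q : Q) : Q := quotient_map (a *: repr q).

Lemma quotient_mapZ (a : R) (x : E) :
  quotient_map (a *: x) = quotient_scale a (quotient_map x).
Proof.
apply/quotient_map_eq; rewrite -scalerBr.
suff: a *: (x - repr (quotient_map x)) \in subspace_pred L by move/set_mem.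
apply: rpredZ; apply/mem_set.
by apply/quotient_map_eq; rewrite /quotient_map reprK.
Qed.

Let scaleA a b q :
  quotient_scale a (quotient_scale b q) = quotient_scale (a * b) q.
Proof.
by have [x <-] := quotient_map_surj q; rewrite -!quotient_mapZ scalerA.
Qed.

Let scale1 : left_id 1 quotient_scale.
Proof.
by move=> q; have [x <-] := quotient_map_surj q; rewrite -quotient_mapZ scale1r.
Qed.

Let scaleDr : right_distributive quotient_scale +%R.
Proof.
move=> a p q; have [x <-] := quotient_map_surj p.
have [y <-] := quotient_map_surj q.
by rewrite -quotient_mapD -!quotient_mapZ scalerDr quotient_mapD.
Qed.

Let scaleDl q : {morph quotient_scale^~ q : a b / a + b}.
Proof.
move=> a b; have [x <-] := quotient_map_surj q.
by rewrite -!quotient_mapZ scalerDl quotient_mapD.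
Qed.

HB.instance Definition _ :=
  GRing.Zmodule_isLmodule.Build R Q scaleA scale1 scaleDr scaleDl.

Definition quotient_norm (q : Q) : R :=
  inf [set `|x| | x in [set x : E | quotient_map x = q]].

Let nset (q : Q) := [set `|x| | x in [set x : E | quotient_map x = q]].

Let nset_lb q : lbound (nset q) 0.
Proof. by move=> _ [x _ <-]. Qed.

Let nset_inf q : has_inf (nset q).
Proof.
split; last by exists 0; exact: nset_lb.
by have [x xq] := quotient_map_surj q; exists `|x|, x.
Qed.

Let norm_le x : quotient_norm (quotient_map x) <= `|x|.
Proof. by apply: ge_inf; [exact: (nset_inf _).2|exists x]. Qed.

Let norm_ge0 q : 0 <= quotient_norm q.
Proof. by apply: lb_le_inf; [exact: (nset_inf _).1|exact: nset_lb]. Qed.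

Let norm_lt q e : 0 < e ->
  exists2 x, quotient_map x = q & `|x| < quotient_norm q + e.
Proof.
by move=> e0; have [_ [x xq <-] ?] := inf_adherent e0 (nset_inf q); exists x.
Qed.

Let normD p q : quotient_norm (p + q) <= quotient_norm p + quotient_norm q.
Proof.
apply/ler_addgt0Pr => e e0; have e2 : 0 < e / 2 by rewrite divr_gt0.
have [x <- xp] := norm_lt p e2; have [y <- yq] := norm_lt q e2.
rewrite -quotient_mapD (le_trans (norm_le _))// (le_trans (ler_normD _ _))//.
by rewrite [e in leRHS]splitr addrACA ltW// ltrD.
Qed.

Let normZ_le a q : quotient_norm (a *: q) <= `|a| * quotient_norm q.
Proof.
apply/ler_addgt0Pr => e e0.
have e1 : 0 < e / (`|a| + 1) by rewrite divr_gt0// ltr_wpDl.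
have [x <- xq] := norm_lt q e1.
rewrite -[_ *: _]quotient_mapZ (le_trans (norm_le _))// normrZ.
rewrite (le_trans (ler_wpM2l _ (ltW xq)))// mulrDr lerD2l.
by rewrite mulrCA ler_piMr// ?ltW// ltr_pdivrMr ?ltr_wpDl// mul1r ltrDl.
Qed.

Let norm0 : quotient_norm 0 = 0.
Proof.
apply/eqP; rewrite eq_le norm_ge0 andbT -quotient_map0.
by rewrite (le_trans (norm_le _))// normr0.
Qed.

Let normZ a q : quotient_norm (a *: q) = `|a| * quotient_norm q.
Proof.
apply/eqP; rewrite eq_le normZ_le/=.
have [->|a0] := eqVneq a 0; first by rewrite normr0 mul0r norm_ge0.
have na : 0 < `|a| by rewrite normr_gt0.
rewrite -ler_pdivlMl// -normfV.
by have := normZ_le a^-1 (a *: q); rewrite scalerA mulVf// scale1r.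
Qed.

Let norm0_eq0 q : quotient_norm q = 0 -> q = 0.
Proof.
have [x <-] := quotient_map_surj q => qx0.
rewrite -quotient_map0; apply/quotient_map_eq; rewrite subr0.
apply: subspace_closed => B /nbhs_ballP[e /= e0 xeB].
have [y yx ye] := norm_lt (quotient_map x) e0.
exists (x - y); split; first exact/quotient_map_eq.
apply: xeB; rewrite -ball_normE /= opprB addrC subrK.
by rewrite qx0 add0r in ye.
Qed.

HB.instance Definition _ :=
  Lmodule_isNormed.Build R Q normD normZ norm0_eq0.

Lemma quotient_normE (q : Q) :
  `|q| = inf [set `|x| | x in [set x : E | quotient_map x = q]].
Proof. by []. Qed.

Lemma quotient_map_linear : linear quotient_map.
Proof. by move=> a x y; rewrite quotient_mapD quotient_mapZ. Qed.

HB.instance Definition _ :=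
  GRing.isLinear.Build R E Q *:%R quotient_map quotient_map_linear.

End QuotientSpace.

Arguments quotient_map {R E} L x.

Definition bounded_operator (R : realType) (V W : normedModType R)
  (f : V -> W) : Prop := exists C : R, forall x : V, `|f x| <= C * `|x|.

Definition finite_dimensional (R : realType) (V : lmodType R) : Prop :=
  exists (n : nat) (b : 'I_n -> V),
    forall v : V, exists c : 'I_n -> R, v = \sum_(i < n) c i *: b i.

Definition finite_codimensional (R : realType) (E : normedModType R)
  (L : closedSubspace E) : Prop := finite_dimensional (quotient_space L).

Definition separable_space (X : topologicalType) : Prop :=
  exists2 D : set X, countable D & dense D.

(* As a subset of [{ptws V -> R^o}], so that its subspace topology, carried by
   [set_type (weak_star_dual V)], is the weak* topology. *)
Definition weak_star_dual (R : realType) (V : normedModType R) :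
    set {ptws V -> R^o} :=
  [set f | linear (f : V -> R^o) /\ bounded_operator (f : V -> R^o)].

Arguments weak_star_dual {R} V.

Definition kato_property (R : realType) (E F : normedModType R) (T : E -> F)
    (L : closedSubspace E) : Prop :=
  forall W : closedSubspace E, finite_codimensional W -> L `<=` W ->
  forall eps : R, 0 < eps ->
  exists2 u : E, (W `\` L) u & `|T u| <= eps * `|quotient_map L u|.

Definition operator_range (R : realType) (E : normedModType R)
    (A : set E) : Prop :=
  exists (G : completeNormedModType R) (S : {linear G -> E}),
    bounded_operator S /\ range S = A.

Definition proper_dense_operator_range (R : realType) (E : normedModType R)
    (A : set E) : Prop :=
  [/\ operator_range A, dense A & A <> setT].

(* Main.v *)
(** Write [A] as the range of a bounded [S : G -> E] and [q x] for the norm of [x]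
    in [E / L].  The space [E1] is the common kernel of functionals [h_n] dominated
    by multiples of [q], built one after the other, each being
    [h_n = d g_m + f + c phi] with the following ingredients.
    - The [g_m] are a sequence with common kernel [L], each used for infinitely many
      [n] and with [f + c phi] of size at most [d / k] on [A] for arbitrarily large
      [k]; hence a vector of [A] killed by all [h_n] lies in [L].
    - [f] is tiny on [A] but not on [E]: it takes the value [1] at an arbitrarily
      small vector.  It exists by Hahn-Banach because [A + L] is not [E] (otherwise
      the open mapping argument would give [L = 0] and [A = E]).
    - [phi], from a gliding hump along the vectors given by the Kato property,
      prevents [h_n] from being controlled by [T] on the common kernel of the
      earlier functionals.  So vectors dual to [h_0, ..., h_n] exist on which [T]
      is as small as we like.
    Given [x] in [A], subtracting a combination of such dual vectors makes finitely
    many [h_j] vanish, and the remaining ones are then cancelled successively by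
    vectors of [A] whose norms are at most [2 ^ -n].  Hence [x] is, up to a small
    error, an element of [E1] plus a finite combination on which [T] is small, which
    gives both the separability of [E / E1] and the density of [T E1] in [T E]. *)

From HB Require Import structures.
Require Import Defs.
From mathcomp Require Import all_boot all_order all_algebra.
From mathcomp Require Import all_classical all_reals all_analysis.
From mathcomp Require Import ring lra.

Set Implicit Arguments.
Unset Strict Implicit.
Unset Printing Implicit Defensive.

Import Order.TTheory GRing.Theory Num.Theory.
Import numFieldNormedType.Exports.
Local Open Scope classical_set_scope.
Local Open Scope ring_scope.

(** * Hahn-Banach for seminorms *)

Lemma scalar_of (R : realType) (V : lmodType R) (f : V -> R) :
  scalar f -> exists g : {scalar V}, forall x, g x = f x.
Proof.
move=> fl; pose fm := GRing.isLinear.Build R V R *%R f fl.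
pose g : {scalar V} := HB.pack f fm.
by exists g.
Qed.

Section HahnBanach.
Variables (R : realType) (V : lmodType R) (p : V -> R).
Hypothesis pD : forall x y, p (x + y) <= p x + p y.
Hypothesis pZ : forall a x, p (a *: x) = `|a| * p x.

(* Partial functionals are encoded by their graphs; the empty graph is allowed
   so that the empty chain has an upper bound. *)
Definition dominated_graph (u : V) (G : set (V * R)) : Prop :=
  [/\ forall a x s y t, G (x, s) -> G (y, t) -> G (a *: x + y, a * s + t),
      forall x s, G (x, s) -> s <= p x
    & G !=set0 -> G (u, p u)].

Lemma seminorm0 : p 0 = 0.
Proof. by rewrite -(scale0r 0) pZ normr0 mul0r. Qed.

Lemma seminorm_ge0 x : 0 <= p x.
Proof.
have := pD x (- x); rewrite subrr seminorm0 -scaleN1r pZ normrN1 mul1r; lra.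
Qed.

(** The value [c] at [x0] is the supremum of the lower bounds [s - p (x - x0)]; subadditivity puts
    each of them below every upper bound [p (y + x0) - t]. *)
Lemma dominated_graph_extend u (G : set (V * R)) (x0 : V) :
  dominated_graph u G -> G !=set0 ->
  exists H, [/\ dominated_graph u H, G `<=` H & exists s, H (x0, s)].
Proof.
move=> [Glin Gp Gu] G0; have Guu := Gu G0.
have G00 : G (0, 0).
  by have := Glin (-1) _ _ _ _ Guu Guu; rewrite scaleN1r mulN1r !addNr.
pose B := [set r : R | exists2 z, G z & r = z.2 - p (z.1 - x0)].
have B0 : B !=set0 by exists (0 - p (0 - x0)); exists (0, 0).
have Bub y t : G (y, t) -> ubound B (p (y + x0) - t).
  move=> Gyt _ [[x s] Gxs ->] /=.
  have := Gp _ _ (Glin 1 _ _ _ _ Gxs Gyt); rewrite scale1r mul1r => h.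
  have := pD (x - x0) (y + x0).
  by rewrite addrACA addNr addr0; lra.
have Bs : has_sup B by split => //; exists (p (0 + x0) - 0); exact: Bub.
pose c := sup B.
have cge x s : G (x, s) -> s - c <= p (x - x0).
  by move=> Gxs; have : s - p (x - x0) <= c;
    [apply: sup_upper_bound => //; exists (x, s) | lra].
have cle x s : G (x, s) -> s + c <= p (x + x0).
  by move=> Gxs; have : c <= p (x + x0) - s;
    [apply: ge_sup => //; exact: Bub | lra].
have Gz a x s : G (x, s) -> G (a *: x, a * s).
  by move=> Gxs; have := Glin a _ _ _ _ Gxs G00; rewrite !addr0.
pose H := [set z : V * R | exists x s a,
  [/\ G (x, s), z.1 = x + a *: x0 & z.2 = s + a * c]].
exists H; split.
- split=> [a _ _ _ _ [x [s [b [Gxs /= -> ->]]]] [y [t [d [Gyt /= -> ->]]]]||_].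
  + exists (a *: x + y), (a * s + t), (a * b + d); split => //=.
    * exact: Glin.
    * by rewrite scalerDr scalerDl scalerA addrACA.
    * by ring.
  + move=> _ _ [x [s [a [Gxs /= -> ->]]]].
    have [a0|a0|->] := ltgtP a 0; last first.
    * by rewrite scale0r mul0r !addr0; exact: Gp.
    * have := cle _ _ (Gz a^-1 _ _ Gxs).
      have -> : a^-1 *: x + x0 = a^-1 *: (x + a *: x0).
        by rewrite scalerDr scalerA mulVf ?scale1r// gt_eqF.
      rewrite pZ gtr0_norm ?invr_gt0// -(ler_pM2l a0).
      by rewrite mulrDr !mulrA divff ?gt_eqF// !mul1r.
    * have na : 0 < - a by rewrite oppr_gt0.
      have := cge _ _ (Gz (- a)^-1 _ _ Gxs).
      have -> : (- a)^-1 *: x - x0 = (- a)^-1 *: (x + a *: x0).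
        rewrite scalerDr scalerA invrN mulNr mulVf ?lt_eqF//.
        by rewrite scaleN1r.
      rewrite pZ gtr0_norm ?invr_gt0// -(ler_pM2l na).
      rewrite mulrBr !mulrA divff ?gt_eqF// !mul1r.
      by rewrite mulNr opprK.
  + by exists u, (p u), 0; split => //=; rewrite ?scale0r ?mul0r addr0.
- by move=> [x s] Gxs; exists x, s, 0; rewrite scale0r mul0r !addr0.
- by exists c, 0, 0, 1; rewrite scale1r mul1r !add0r.
Qed.

(** Zorn gives a maximal dominated graph. It is total by one-step extension and single-valued
    because two values at a point differ by at most [p 0 = 0]. *)
Lemma seminorm_Hahn_Banach u :
  exists f : {scalar V}, f u = p u /\ forall x, `|f x| <= p x.
Proof.
have [G [Gd Gmax]] : exists G, dominated_graph u G /\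
    forall H, G `<` H -> ~ dominated_graph u H.
  apply: Zorn_bigcup => F FP Ftot; split.
  - move=> a x s y t [X FX Xxs] [Y FY Yyt].
    have [XY|YX] := Ftot _ _ FX FY.
    + by exists Y => //; case: (FP _ FY) => + _ _; apply => //; exact: XY.
    + by exists X => //; case: (FP _ FX) => + _ _; apply => //; exact: YX.
  - by move=> x s [X FX Xxs]; case: (FP _ FX) => _ + _; apply.
  - move=> [z [X FX Xz]]; exists X => //; case: (FP _ FX) => _ _; apply.
    by exists z.
have G0 : G !=set0.
  apply/set0P/negP => /eqP GE.
  (* The line through [u] is a dominated graph, so the empty graph is not maximal. *)
  pose H := [set z : V * R | exists a, z = (a *: u, a * p u)].
  apply: (Gmax H).
    rewrite GE; split; first exact: sub0set.
    by move=> /(_ (1 *: u, 1 * p u)); apply; exists 1.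
  split=> [a _ _ _ _ [b [-> ->]] [d [-> ->]]|_ _ [a [-> ->]]|_].
  - by exists (a * b + d); rewrite scalerA scalerDl mulrDl mulrA.
  - by rewrite pZ ler_wpM2r ?seminorm_ge0 ?ler_norm.
  - by exists 1; rewrite scale1r mul1r.
have [Glin Gp Gu] := Gd.
have Gtot x : exists s, G (x, s).
  have [H [Hd GH [s Hs]]] := dominated_graph_extend x Gd G0.
  exists s; apply: contrapT => nG; apply: (Gmax H) => //; split => //.
  by move=> /(_ _ Hs).
have Guniq x s t : G (x, s) -> G (x, t) -> s = t.
  move=> Gs Gt.
  have h a b : G (x, a) -> G (x, b) -> a <= b.
    move=> Ga Gb; have := Gp _ _ (Glin (-1) _ _ _ _ Gb Ga).
    by rewrite scaleN1r addNr seminorm0; lra.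
  by apply/eqP; rewrite eq_le !h.
have [f fG] := choice Gtot.
have [g gE] : exists g : {scalar V}, forall x, g x = f x.
  apply: scalar_of => a x y.
  by apply: (Guniq (a *: x + y)); [exact: fG|exact: Glin].
exists g; split; first by rewrite gE; apply: (Guniq u); [exact: fG|exact: Gu].
move=> x; rewrite ler_norml -[- p x]opprK lerNl opprK; apply/andP; split.
  have -> : - g x = g (- x) by rewrite raddfN.
  rewrite gE; have -> : p x = p (- x) by rewrite -scaleN1r pZ normrN1 mul1r.
  exact: Gp (fG _).
by rewrite gE; exact: Gp (fG _).
Qed.

End HahnBanach.

(** * Geometric convergence and choice along finite histories *)

Section Geometric.
Variable R : realType.

Lemma half_expr_small (C e : R) : 0 < e ->
  exists N, forall n, (N <= n)%N -> C * 2^-1 ^+ n < e.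
Proof.
move=> e0; exists (Num.bound (C / e)) => n /upper_nthrootP.
by rewrite ltr_pdivrMr// exprVn ltr_pdivrMr ?exprn_gt0// mulrC.
Qed.

Lemma geometric_limit (V : completeNormedModType R) (z : nat -> V) (C : R) :
  (forall n, `|z n.+1 - z n| <= C * 2^-1 ^+ n) ->
  exists l, forall n, `|l - z n| <= 2 * C * 2^-1 ^+ n.
Proof.
move=> zC.
have C0 : 0 <= C by have := le_trans (normr_ge0 _) (zC 0%N); rewrite expr0 mulr1.
have zz n k : `|z (n + k)%N - z n| <= 2 * C * 2^-1 ^+ n.
  (* Keeping the subtracted tail makes the induction on [k] close. *)
  suff: `|z (n + k)%N - z n| <= 2 * C * (2^-1 ^+ n - 2^-1 ^+ (n + k)).
    move=> /le_trans; apply; rewrite ler_wpM2l ?mulr_ge0//.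
    by rewrite lerBlDr lerDl exprn_ge0// invr_ge0.
  elim: k => [|k ih]; first by rewrite addn0 !subrr normr0 mulr0.
  rewrite addnS -(subrKA (z (n + k)%N)) (le_trans (ler_normD _ _))//.
  apply: (le_trans (lerD (zC _) ih)); rewrite exprS le_eqVlt; apply/orP; left.
  by apply/eqP; field.
have /cauchy_cvgP zcvg : cauchy (z @ \oo).
  apply: cauchy_exP => e e0.
  have [N HN] := half_expr_small (2 * C) e0.
  exists (z N), N => // m /= Nm; rewrite -ball_normE /ball_/= distrC.
  by rewrite -(subnKC Nm) (le_lt_trans (zz _ _))// HN.
exists (lim (z @ \oo)) => n; apply/ler_addgt0Pr => e e0.
have /cvgrPdist_le /(_ e e0) [N _ HN] := zcvg.
rewrite -(subrKA (z (n + N)%N)) addrC (le_trans (ler_normD _ _))// lerD//.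
exact/HN/leq_addl.
Qed.

End Geometric.

(** Dependent choice in which each term may depend on the whole finite history, as the stages of the
    construction do. *)
Lemma history_choice (X : Type) (P : seq X -> Prop) (Q : seq X -> X -> Prop) :
  P [::] -> (forall s, P s -> exists x, P (rcons s x) /\ Q s x) ->
  exists f : nat -> X, forall n, P (mkseq f n) /\ Q (mkseq f n) (f n).
Proof.
move=> P0 PS.
have [x0 _] := PS _ P0.
have /choice[c cP] : forall s, exists x, P s -> P (rcons s x) /\ Q s x.
  by move=> s; have [/PS[x]|nP] := pselect (P s); [exists x|exists x0].
pose F := fix F n := if n is m.+1 then rcons (F m) (c (F m)) else [::].
have PF n : P (F n) by elim: n => //= n /cP[].
exists (fun n => c (F n)) => n.
suff -> : mkseq (fun m => c (F m)) n = F n by split; [exact: PF|apply: (cP _ _).2].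
by elim: n => [//|n ih]; rewrite mkseqS ih.
Qed.

(** * Gliding hump *)

Section GlidingHump.
Variables (R : realType) (V : lmodType R) (p : V -> R).
Hypothesis pD : forall x y, p (x + y) <= p x + p y.
Hypothesis pZ : forall a x, p (a *: x) = `|a| * p x.

Let q3 : R := 3^-1.

(* Each sign is chosen so that the new term does not cancel the partial sum at
   [v k]; the geometric tail is at most half of that term. *)
Lemma gliding_hump (v : nat -> V) : exists f : {scalar V},
  (forall x, `|f x| <= p x) /\
  forall k, 3^-1 ^+ k.+1 / 2 * p (v k) <= `|f (v k)|.
Proof.
have p0 x : 0 <= p x by exact: seminorm_ge0.
have q30 k : 0 < q3 ^+ k by rewrite exprn_gt0// invr_gt0.
have q3_1 : q3 <= 1 by rewrite /q3 invf_le1// ler1n.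
have q3_le n : q3 ^+ n <= 2^-1 ^+ n.
  by rewrite lerXn2r ?nnegrE ?invr_ge0// lef_pV2 ?posrE// ler_nat.
have /choice[g gP] k := seminorm_Hahn_Banach pD pZ (v k).
pose z := fix z n : V -> R := if n is k.+1 then
  fun x => z k x + (if 0 <= z k (v k) then 1 else -1) * q3 ^+ k.+1 * g k x
  else fun=> 0.
have zlin n : scalar (z n).
  elim: n => [|n ih] a x y /=; first by rewrite mulr0 addr0.
  by rewrite ih linearP/=; ring.
have zS n x : `|z n.+1 x - z n x| <= q3 ^+ n.+1 * p x.
  rewrite /= addrAC subrr add0r !normrM (ger0_norm (ltW (q30 _))).
  apply: ler_pM => //; [by rewrite mulr_ge0// ltW| |exact: (gP n).2].
  by case: ifP; rewrite ?normrN1 ?normr1 mul1r.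
have zz n k x : `|z (n + k)%N x - z n x| <= q3 ^+ n / 2 * p x.
  suff: `|z (n + k)%N x - z n x| <= (q3 ^+ n - q3 ^+ (n + k)) / 2 * p x.
    move=> /le_trans; apply; rewrite ler_wpM2r// ler_wpM2r ?invr_ge0//.
    by rewrite lerBlDr lerDl ltW.
  elim: k => [|k ih]; first by rewrite addn0 !subrr normr0 !mul0r.
  rewrite addnS -(subrKA (z (n + k)%N x)) (le_trans (ler_normD _ _))//.
  apply: (le_trans (lerD (zS _ _) ih)); rewrite exprS le_eqVlt; apply/orP; left.
  by apply/eqP; rewrite /q3; field.
have /choice[f fP] x : exists l : R, forall n, `|l - z n x| <= q3 ^+ n / 2 * p x.
  (* The limit is found at ratio 1/2; the sharper error at ratio 1/3 then passes to it from [zz]. *)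
  have [l lP] : exists l : R^o, forall n, `|l - z n x| <= 2 * p x * 2^-1 ^+ n.
    apply: (geometric_limit (V := R^o)) => n; rewrite (le_trans (zS _ _))//.
    by rewrite mulrC ler_wpM2l// exprS -[leRHS]mul1r ler_pM ?q3_le ?(ltW (q30 _))// invr_ge0.
  exists l => n; apply/ler_addgt0Pr => e e0.
  have [N HN] := half_expr_small (2 * p x) e0.
  rewrite -(subrKA (z (n + N)%N x)) addrC (le_trans (ler_normD _ _))// lerD//.
  by rewrite (le_trans (lP _))// ltW// HN// leq_addl.
have flin : scalar f.
  move=> a x y; apply/eqP; rewrite -subr_eq0 -normr_le0.
  apply/ler_addgt0Pr => e e0; rewrite add0r.
  pose C := p (a *: x + y) + `|a| * p x + p y.
  have [N HN] := half_expr_small C e0.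
  rewrite (le_trans _ (ltW (HN N (leqnn _))))//.
  have -> : f (a *: x + y) - (a * f x + f y) =
     (f (a *: x + y) - z N (a *: x + y)) - a * (f x - z N x) - (f y - z N y).
    by rewrite zlin; ring.
  rewrite (le_trans (ler_normB _ _))// (le_trans (lerD (ler_normB _ _) (lexx _)))//.
  rewrite /C !mulrDl normrM.
  have h w : `|f w - z N w| <= p w * 2^-1 ^+ N.
    rewrite (le_trans (fP _ _))// mulrC ler_wpM2l//.
    by rewrite (le_trans _ (q3_le N))// ler_piMr ?(ltW (q30 _))// invf_le1// ler1n.
  by rewrite !lerD// -mulrA ler_wpM2l.
have [F FE] := scalar_of flin; exists F; split => [x|k]; rewrite FE.
  have := fP x 0%N; rewrite subr0 expr0 => /le_trans; apply.
  by rewrite mul1r ler_piMl// invf_le1// ler1n.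
(* By the choice of sign, the partial sum up to term [k] is at least [a] in absolute value at [v k],
   while the tail is at most [a / 2]. *)
have := fP (v k) k.+1; rewrite /= (gP k).1 => h.
set a := q3 ^+ k.+1 * p (v k).
have a0 : 0 <= a by rewrite mulr_ge0// ltW.
have -> : 3^-1 ^+ k.+1 / 2 * p (v k) = a / 2 by rewrite /a /q3; ring.
have : `|f (v k) - (z k (v k) + (if 0 <= z k (v k) then 1 else -1) * a)| <= a / 2.
  by rewrite /a mulrA (le_trans h)//; rewrite /q3 mulrAC.
have [z0|z0] := leP 0 (z k (v k)).
  rewrite ler_norml => /andP[h1 h2]; rewrite ler_normr; apply/orP; left; lra.
rewrite ler_norml => /andP[h1 h2]; rewrite ler_normr; apply/orP; right; lra.
Qed.

(** Choose [v k] in [Z] with [t (v k)] below [c k / (k + 1) * p (v k)], where [c k] is the hump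
    constant; then [|f (v k)|] exceeds [(k + 1) * t (v k)]. *)
Lemma undominated_functional (t : V -> R) (Z : set V) :
  (forall v, 0 <= t v) ->
  (forall e, 0 < e -> exists2 v, Z v & t v < e * p v) ->
  exists f : {scalar V}, (forall x, `|f x| <= p x) /\
    forall C, 0 <= C -> exists2 v, Z v & C * t v < `|f v|.
Proof.
move=> t0 Zt.
pose c k : R := 3^-1 ^+ k.+1 / 2.
have c0 k : 0 < c k by rewrite divr_gt0// exprn_gt0// invr_gt0.
have /choice[v vP] k : exists v, Z v /\ t v < c k / k.+1%:R * p v.
  by have [|v] := Zt (c k / k.+1%:R); [rewrite divr_gt0|exists v].
have [f [fp fv]] := gliding_hump v.
exists f; split=> // C C0; exists (v (Num.bound C)); first exact: (vP _).1.
set k := Num.bound C; apply: lt_le_trans (fv k); rewrite -/(c k).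
have p0 : 0 <= p (v k) by exact: seminorm_ge0.
have := (vP k).2; rewrite mulrAC ltr_pdivlMr// => h.
apply: le_lt_trans h; rewrite mulrC ler_wpM2l// (le_trans (ltW (archi_boundP C0)))//.
by rewrite ler_nat.
Qed.

End GlidingHump.

(** * Functionals small on an operator range *)

Section QuotientSeminorm.
Variables (R : realType) (E : normedModType R) (L : closedSubspace E).

Definition qnorm (x : E) : R := `|quotient_map L x|.

Lemma qnorm_ge0 x : 0 <= qnorm x. Proof. exact: normr_ge0. Qed.

Lemma qnormD x y : qnorm (x + y) <= qnorm x + qnorm y.
Proof. by rewrite /qnorm quotient_mapD ler_normD. Qed.

Lemma qnormZ a x : qnorm (a *: x) = `|a| * qnorm x.
Proof. by rewrite /qnorm linearZ normrZ. Qed.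

Lemma qnormN x : qnorm (- x) = qnorm x.
Proof. by rewrite /qnorm linearN normrN. Qed.

Lemma qnormB x y : qnorm (x - y) <= qnorm x + qnorm y.
Proof. by rewrite -(qnormN y) qnormD. Qed.

Lemma qnorm_le x : qnorm x <= `|x|.
Proof.
rewrite /qnorm quotient_normE; apply: ge_inf; last by exists x.
by exists 0 => _ [y _ <-].
Qed.

Lemma qnorm_eq0 x : qnorm x = 0 <-> subspace_set L x.
Proof.
have <- : (quotient_map L x = quotient_map L 0) <-> subspace_set L x.
  by rewrite quotient_map_eq subr0.
rewrite quotient_map0 /qnorm; split => [/normr0_eq0//|->]; exact: normr0.
Qed.

Lemma subspace0 : subspace_set L 0.
Proof. by apply/set_mem; exact: (subspace_submod L).1. Qed.

Lemma qnorm_eq0l x y : qnorm (x - y) = 0 -> qnorm x = qnorm y.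
Proof.
move=> /qnorm_eq0/quotient_map_eq; by rewrite /qnorm => ->.
Qed.

Lemma qnorm_lift x e : 0 < e -> exists2 y, qnorm (x - y) = 0 & `|y| < qnorm x + e.
Proof.
move=> e0.
have hi : has_inf [set `|y| | y in [set y | quotient_map L y = quotient_map L x]].
  by split; [exists `|x|, x|exists 0 => _ [y _ <-]].
have [_ [y yx <-] ye] := inf_adherent e0 hi.
exists y => //; rewrite /qnorm raddfB/= yx subrr; exact: normr0.
Qed.

End QuotientSeminorm.

(** These are the bounded functionals on [E / L], pulled back to [E]. *)
Definition qbounded (R : realType) (E : normedModType R) (L : closedSubspace E)
  (f : E -> R) : Prop := exists2 B : R, 0 <= B & forall x, `|f x| <= B * qnorm L x.

Section DenseRange.
Variables (R : realType) (E G : completeNormedModType R) (L : closedSubspace E).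
Variables (S : {linear G -> E}) (M : R).
Hypothesis M0 : 0 <= M.
Hypothesis SM : forall w, `|S w| <= M * `|w|.
Hypothesis Sdense : forall x e, 0 < e -> exists w, `|x - S w| < e.
Local Notation q := (qnorm L).

(** The iteration of the open mapping theorem: each correction halves the remainder, and the
    corrections form a convergent series in [G]. *)
Lemma approximate_lifting (C : R) :
  (forall x, exists w, `|w| <= C * q x /\ q (x - S w) <= q x / 2) ->
  forall x, exists w, `|w| <= 2 * (C * q x) /\ q (x - S w) = 0.
Proof.
move=> /choice[w wP] x.
pose W := fix W n := if n is k.+1 then W k + w (x - S (W k)) else 0.
have qW n : q (x - S (W n)) <= q x * 2^-1 ^+ n.
  elim: n => [|n ih] /=; first by rewrite linear0 subr0 expr0 mulr1.
  rewrite linearD opprD addrA (le_trans (wP _).2)// exprSr mulrA.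
  by rewrite ler_wpM2r ?invr_ge0.
(* A negative [C] forces [q] to vanish identically, and [0] is then a lifting. *)
have [C0|C0] := ltP C 0.
  have qx0 y : q y = 0.
    have := (wP y).1; have := qnorm_ge0 L y; have := normr_ge0 (w y).
    by move=> h1 h2 h3; apply/eqP; rewrite eq_le h2 andbT; nra.
  by exists 0; rewrite normr0 !qx0 !mulr0.
have WS n : `|W n.+1 - W n| <= C * q x * 2^-1 ^+ n.
  by rewrite /= addrAC subrr add0r (le_trans (wP _).1)// -mulrA ler_wpM2l.
have [l lP] := geometric_limit WS.
exists l; split.
  by have := lP 0%N; rewrite subr0 expr0 mulr1.
apply/eqP; rewrite eq_le qnorm_ge0 andbT.
apply/ler_addgt0Pr => e e0; rewrite add0r.
have [N HN] := half_expr_small (q x + M * (2 * (C * q x))) e0.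
apply: le_trans (ltW (HN N (leqnn _))).
rewrite (_ : x - S l = (x - S (W N)) - S (l - W N)); last first.
  by rewrite linearB opprB addrA addrNK.
rewrite (le_trans (qnormB _ _ _))// mulrDl lerD//.
rewrite (le_trans (qnorm_le _ _))// (le_trans (SM _))// -mulrA.
by rewrite ler_wpM2l.
Qed.

Hypothesis Sproper : exists x, forall w, S w <> x.
Hypothesis SL : forall w, subspace_set L (S w) -> S w = 0.

(* Otherwise [L + range S] is everything, with control of the lifting; applied to
   an [l] in [L] approximated by the range, this makes [L] trivial. *)
Lemma no_approximate_lifting (C : R) :
  ~ forall x, exists w, `|w| <= C * q x /\ q (x - S w) <= q x / 2.
Proof.
move=> /approximate_lifting lift.
have L0 l : subspace_set L l -> l = 0.
  move=> Ll; apply/eqP; rewrite -normr_le0; apply/ler_addgt0Pr => e e0.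
  rewrite add0r; pose K := 1 + M * (2 * `|C|).
  have K0 : 0 < K by rewrite ltr_pwDl// !mulr_ge0.
  have [p pe] := Sdense l (divr_gt0 e0 K0).
  have [w [we qw]] := lift (l - S p).
  have l0 : q l = 0 by apply/qnorm_eq0.
  (* Modulo [L], both [l] and [l - S p - S w] vanish, so [S (p + w)] lies in [L] and is [0]. *)
  have -> : l = l - S (p + w).
    rewrite (SL (w := p + w)) ?subr0//; apply/qnorm_eq0.
    apply/eqP; rewrite eq_le qnorm_ge0 andbT.
    rewrite (_ : S (p + w) = l - (l - S p - S w)); last by rewrite linearD -addrA -opprD subKr.
    by rewrite (le_trans (qnormB _ _ _))// l0 qw addr0.
  rewrite linearD opprD addrA (le_trans (ler_normB _ _))//.
  have -> : e = e / K + M * (2 * (`|C| * (e / K))).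
    by rewrite -{1}(divfK (lt0r_neq0 K0) e) /K; ring.
  rewrite lerD ?(ltW pe)// (le_trans (SM _))// ler_wpM2l// (le_trans we)//.
  rewrite ler_wpM2l// (le_trans (ler_wpM2r (qnorm_ge0 _ _) (ler_norm C)))//.
  by rewrite ler_wpM2l// (le_trans (qnorm_le _ _))// ltW.
have [x Sx] := Sproper.
have [w [_ qw]] := lift x.
apply: (Sx w); apply/esym/eqP; rewrite -subr_eq0; apply/eqP/L0.
exact/qnorm_eq0.
Qed.

Section Gauge.
Variables K t : R.
Hypotheses (K0 : 0 <= K) (t0 : 0 <= t).

(** The largest seminorm that is at most [K * q] on [E] and at most [t * |w|] at each [S w]. A
    functional below it is bounded on [E / L] and small on the range. *)
Definition gauge (x : E) : R :=
  inf [set r | exists w, r = K * q (x - S w) + t * `|w|].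

Lemma gauge_le x w : gauge x <= K * q (x - S w) + t * `|w|.
Proof.
apply: ge_inf; last by exists w.
by exists 0 => _ [v ->]; rewrite addr_ge0// mulr_ge0// qnorm_ge0.
Qed.

Lemma gauge_approx x e : 0 < e ->
  exists w, K * q (x - S w) + t * `|w| < gauge x + e.
Proof.
move=> e0.
have hi : has_inf [set r | exists w, r = K * q (x - S w) + t * `|w|].
  split; first by exists (K * q (x - S 0) + t * `|0 : G|), 0.
  by exists 0 => _ [v ->]; rewrite addr_ge0// mulr_ge0// qnorm_ge0.
by have [_ [w ->] ?] := inf_adherent e0 hi; exists w.
Qed.

Lemma gaugeD x y : gauge (x + y) <= gauge x + gauge y.
Proof.
apply/ler_addgt0Pr => e e0; have e2 : 0 < e / 2 by rewrite divr_gt0.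
have [v vx] := gauge_approx x e2; have [w wy] := gauge_approx y e2.
rewrite (le_trans (gauge_le _ (v + w)))// linearD opprD addrACA.
have h1 := qnormD L (x - S v) (y - S w); have h2 := ler_normD v w.
have := ler_wpM2l K0 h1; have := ler_wpM2l t0 h2; lra.
Qed.

Lemma gaugeZ a x : gauge (a *: x) = `|a| * gauge x.
Proof.
have le b y : gauge (b *: y) <= `|b| * gauge y.
  apply/ler_addgt0Pr => e e0.
  have e1 : 0 < e / (`|b| + 1) by rewrite divr_gt0// ltr_wpDl.
  have [w yw] := gauge_approx y e1.
  rewrite (le_trans (gauge_le _ (b *: w)))// linearZ/= -scalerBr qnormZ normrZ.
  rewrite [leLHS](_ : _ = `|b| * (K * q (y - S w) + t * `|w|)); last by ring.
  rewrite (le_trans (ler_wpM2l _ (ltW yw)))// mulrDr lerD2l.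
  by rewrite mulrCA ler_piMr// ?ltW// ltr_pdivrMr ?ltr_wpDl// mul1r ltrDl.
apply/eqP; rewrite eq_le le/=.
have [->|a0] := eqVneq a 0.
  rewrite normr0 mul0r; have := le 0 0; rewrite normr0 mul0r scale0r => _.
  apply: lb_le_inf; first by exists (K * q (0 *: x - S 0) + t * `|0 : G|), 0.
  by move=> _ [v ->]; rewrite addr_ge0// mulr_ge0// qnorm_ge0.
have na : 0 < `|a| by rewrite normr_gt0.
rewrite -ler_pdivlMl// -normfV.
by have := le a^-1 (a *: x); rewrite scalerA mulVf// scale1r.
Qed.

End Gauge.

Section DualSystem.
Variables (n : nat) (h : nat -> {scalar E}) (y : nat -> G).
Hypothesis hq : forall j, (j < n)%N -> qbounded L (h j).
Hypothesis hy : forall i j, (i < n)%N -> (j < n)%N -> h i (S (y j)) = (i == j)%:R.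

(** For a dual system, [S (dual_comb x)] has the same values as [x] under the [h j]; subtracting it
    projects onto their common kernel. *)
Definition dual_comb (x : E) : G := \sum_(j < n) h j x *: y j.

Lemma dual_comb_bound :
  exists2 B : R, 0 <= B & forall x, `|dual_comb x| <= B * q x.
Proof.
have /choice[b bP] (j : nat) : exists b : R, (j < n)%N ->
    0 <= b /\ forall x, `|h j x| <= b * q x.
  by have [/hq[b]|] := boolP (j < n)%N; [exists b|exists 0].
exists (\sum_(j < n) b j * `|y j|) => [|x].
  by apply: sumr_ge0 => j _; rewrite mulr_ge0// (bP _ _).1.
rewrite (le_trans (ler_norm_sum _ _ _))// mulr_suml ler_sum// => j _.
by rewrite normrZ mulrAC ler_wpM2r// (bP _ _).2.
Qed.

Lemma functional_dual_comb i x : (i < n)%N -> h i (S (dual_comb x)) = h i x.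
Proof.
move=> ni; rewrite !linear_sum (bigD1 (Ordinal ni))//= big1 => [|j /eqP ji].
  by rewrite !linearZ/= hy// eqxx mulr1 addr0.
rewrite !linearZ/= hy//; have [ij|] := eqVneq i j; last by rewrite mulr0.
by case: ji; apply: val_inj.
Qed.

Definition dual_proj (x : E) : E := x - S (dual_comb x).

Lemma dual_proj_ker i x : (i < n)%N -> h i (dual_proj x) = 0.
Proof. by move=> ni; rewrite raddfB/= functional_dual_comb// subrr. Qed.

Lemma dual_proj_range p : dual_proj (S p) = S (p - dual_comb (S p)).
Proof. by rewrite linearB. Qed.

(** Hahn-Banach for [gauge K t] at [S p] gives [f] once the gauge there is at least 1. If it is
    below 1 for all admissible [p] and all [K], rescaling produces the approximate lifting excluded
    above. *)
Lemma small_dominated_functional (t e : R) : 0 < t -> 0 < e ->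
  exists (f : {scalar E}) (p : G),
    [/\ qbounded L f, forall w, `|f (S w)| <= t * `|w|, `|S p| <= e,
       forall j, (j < n)%N -> h j (S p) = 0 & 1 <= f (S p)].
Proof.
move=> t0 e0; apply: contrapT => nf.
have small p K : 0 < K -> `|S p| <= e ->
    (forall j, (j < n)%N -> h j (S p) = 0) ->
    exists w, K * q (S p - S w) + t * `|w| < 1.
  move=> K0 pe hp; have K0' := ltW K0; have t0' := ltW t0.
  have [g1|g1] := leP 1 (gauge K t (S p)); last first.
    have g2 : 0 < 1 - gauge K t (S p) by rewrite subr_gt0.
    have [w] := gauge_approx K0' t0' (S p) g2.
    by rewrite [ltRHS]addrC subrK; exists w.
  exfalso; apply: nf.
  have [f [fp fg]] := seminorm_Hahn_Banach (gaugeD K0' t0') (gaugeZ K0' t0') (S p).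
  exists f, p; split => //; last by rewrite fp.
  - exists K => // x; rewrite (le_trans (fg _))//.
    have := gauge_le K0' t0' x 0.
    by rewrite linear0 subr0 normr0 mulr0 addr0.
  - move=> w; rewrite (le_trans (fg _))//.
    have := gauge_le K0' t0' (S w) w; rewrite subrr.
    by rewrite (_ : q 0 = 0) ?mulr0 ?add0r//; apply/qnorm_eq0/subspace0.
have [B B0 HB] := dual_comb_bound.
pose C1 := 1 + M * B; have C10 : 0 < C1 by rewrite ltr_pwDl// mulr_ge0.
(* The first term of the constant bounds [v = s^-1 *: w], the second the dual combination of
   [S p]. *)
apply: (@no_approximate_lifting (3 * C1 / (e * t) + 3 * B)) => x.
have [qx|qx] := eqVneq (q x) 0.
  by exists 0; rewrite linear0 subr0 normr0 qx !mulr0 mul0r.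
have a0 : 0 < q x by rewrite lt_neqAle eq_sym qx qnorm_ge0.
set a := q x in a0 *.
(* A representative of norm below [2 * a] keeps [S p] within [3 * a]. *)
have [x' xx' x'a] := qnorm_lift L x a0.
have [p xp] := Sdense x' (divr_gt0 a0 (ltr0n R 4)).
have ra : `|S p| <= 3 * a.
  rewrite (_ : S p = x' - (x' - S p)); last by rewrite subKr.
  by rewrite (le_trans (ler_normB _ _))//; rewrite /a in x'a xp *; lra.
pose p' := p - dual_comb (S p).
have pE : S p' = S p - S (dual_comb (S p)) by rewrite linearB.
have ra' : `|S p'| <= C1 * (3 * a).
  rewrite pE (le_trans (ler_normB _ _))// /C1 mulrDl mul1r lerD//.
  rewrite (le_trans (SM _))// -mulrA ler_wpM2l// (le_trans (HB _))// ler_wpM2l//.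
  exact: le_trans (qnorm_le _ _) ra.
pose s := e / (C1 * (3 * a)).
have s0 : 0 < s by rewrite divr_gt0// !mulr_gt0.
(* The scale [s] brings [S p'] down to norm [e]; this [K] leaves a remainder [a / 4], and [x' - S p]
   contributes at most another [a / 4]. *)
have [||j nj|w wlt] := small (s *: p') (4 / (s * a)).
- by rewrite divr_gt0// mulr_gt0.
- rewrite linearZ normrZ gtr0_norm// /s -mulrA ler_piMr ?(ltW e0)//.
  by rewrite mulrC ler_pdivrMr ?mul1r// !mulr_gt0.
- by rewrite !linearZ/= /p' -dual_proj_range dual_proj_ker// mulr0.
pose v := s^-1 *: w.
have vE : S (s *: p') - S w = s *: (S p' - S v).
  have -> : S w = s *: S v by rewrite /v linearZ/= scalerA divff ?scale1r// gt_eqF.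
  by rewrite linearZ/= scalerBr.
rewrite vE qnormZ gtr0_norm// in wlt.
have qv : q (S p' - S v) <= a / 4.
  have : 4 / a * q (S p' - S v) <= 1.
    rewrite (le_trans _ (ltW wlt))// -[leLHS]addr0 lerD ?(mulr_ge0 (ltW t0))//.
    by rewrite le_eqVlt; apply/orP; left; apply/eqP; field; rewrite !gt_eqF.
  by rewrite mulrAC ler_pdivrMr// mul1r ler_pdivlMr// mulrC.
have wt : `|w| <= t^-1.
  rewrite -[t^-1]mul1r ler_pdivlMr// mulrC (le_trans _ (ltW wlt))//.
  have sa0 : 0 <= 4 / (s * a) by rewrite ltW// divr_gt0// mulr_gt0.
  by rewrite lerDr; apply: mulr_ge0 => //; apply: mulr_ge0; [exact: ltW|exact: qnorm_ge0].
exists (v + dual_comb (S p)); split.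
  rewrite (le_trans (ler_normD _ _))// mulrDl lerD//.
    rewrite /v normrZ gtr0_norm ?invr_gt0// (le_trans (ler_wpM2l _ wt))//.
      by rewrite invr_ge0 ltW.
    by rewrite le_eqVlt; apply/orP; left; apply/eqP; rewrite /s; field;
      rewrite !gt_eqF.
  rewrite (le_trans (HB _))// (mulrC 3 B) -mulrA ler_wpM2l//.
  exact: le_trans (qnorm_le _ _) ra.
rewrite (@qnorm_eq0l _ _ L _ (x' - S (v + dual_comb (S p)))); last first.
  by rewrite opprB addrA subrK.
rewrite (_ : _ - _ = (x' - S p) + (S p' - S v)); last first.
  by rewrite pE linearD opprD addrA [in RHS]addrA subrKA addrAC.
have := qnormD L (x' - S p) (S p' - S v); have := qnorm_le L (x' - S p).
by move: qv xp; rewrite -/a; lra.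
Qed.

End DualSystem.

End DenseRange.

(** * One step of the construction *)

Lemma scalar_comb (R : realType) (V : lmodType R) (a b : R) (f g : {scalar V}) :
  exists k : {scalar V}, forall x, k x = a * f x + b * g x.
Proof. by apply: scalar_of => c x y; rewrite !linearP/=; ring. Qed.

(** The sign of [a * b] gives [|a + s * b| = |a| + |b|]. *)
Lemma no_cancel_sign (R : realType) (a b : R) :
  exists2 s : R, `|s| = 1 & `|a| <= `|a + s * b| /\ `|b| <= `|a + s * b|.
Proof.
have [ab|ab] := leP 0 (a * b).
  exists 1; rewrite ?normr1// mul1r.
  by case: (ger0P a) => a0; case: (ger0P b) => b0; case: (ger0P (a + b)) => c0;
    split; nra.
exists (-1); rewrite ?normrN1// mulN1r.
by case: (ger0P a) => a0; case: (ger0P b) => b0; case: (ger0P (a - b)) => c0;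
  split; nra.
Qed.

Section Kernel.
Variables (R : realType) (E : normedModType R) (L : closedSubspace E).

(** Applied to finitely many functionals, this gives the test subspaces for the Kato property;
    applied to all of them, [E1]. *)
Lemma kernel_closedSubspace (P : nat -> Prop) (h : nat -> {scalar E}) :
  (forall j, P j -> qbounded L (h j)) ->
  exists W : closedSubspace E,
    forall x, subspace_set W x <-> forall j, P j -> h j x = 0.
Proof.
move=> hq; pose K := [set x | forall j, P j -> h j x = 0].
have Ksub : submod_closed (mem K).
  split; first by apply/mem_set => j _; rewrite linear0.
  move=> a x y /set_mem xK /set_mem yK; apply/mem_set => j Pj.
  by rewrite linearP/= xK// yK// mulr0 addr0.
have Kclosed : closed K.
  move=> x xK j Pj; have [B B0 hB] := hq _ Pj.
  apply/eqP; rewrite -normr_le0; apply/ler_addgt0Pr => e e0; rewrite add0r.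
  have eB : 0 < e / (B + 1) by rewrite divr_gt0// ltr_wpDl.
  have [y [yK]] := xK _ (nbhsx_ballx x _ eB).
  rewrite -ball_normE /ball_/= => xy.
  have -> : h j x = h j (x - y) by rewrite raddfB/= [h j y]yK// subr0.
  rewrite (le_trans (hB _))// (le_trans (ler_wpM2l B0 (qnorm_le _ _)))//.
  rewrite (le_trans (ler_wpM2l B0 (ltW xy)))// mulrCA ler_piMr ?(ltW e0)//.
  by rewrite ler_pdivrMr ?mul1r ?lerDl// ltr_wpDl.
by exists (ClosedSubspace Ksub Kclosed).
Qed.

End Kernel.

Section Step.
Variables (R : realType) (E F G : completeNormedModType R).
Variables (L : closedSubspace E) (S : {linear G -> E}) (M : R).
Variables (T : {linear E -> F}) (N : R).
Hypothesis M0 : 0 <= M.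
Hypothesis SM : forall w, `|S w| <= M * `|w|.
Hypothesis N0 : 0 <= N.
Hypothesis TN : forall x, `|T x| <= N * `|x|.
Hypothesis Sdense : forall x e, 0 < e -> exists w, `|x - S w| < e.
Hypothesis Sproper : exists x, forall w, S w <> x.
Hypothesis SL : forall w, subspace_set L (S w) -> S w = 0.
Hypothesis TL : kato_property T L.
Local Notation q := (qnorm L).

(** A Kato vector [u] of the common kernel is approximated by some [S w], which [dual_proj] moves
    back into the kernel without leaving the range. *)
Lemma kato_in_range n (h : nat -> {scalar E}) (y : nat -> G) :
  (forall j, (j < n)%N -> qbounded L (h j)) ->
  (forall i j, (i < n)%N -> (j < n)%N -> h i (S (y j)) = (i == j)%:R) ->
  forall e, 0 < e -> exists p, (forall j, (j < n)%N -> h j (S p) = 0) /\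
    `|T (S p)| < e * q (S p).
Proof.
move=> hq hy e e0.
have [W WP] := @kernel_closedSubspace _ _ L (fun j => j < n)%N h hq.
have Wfin : finite_codimensional W.
  exists n, (fun i => quotient_map W (S (y i))) => v.
  have [x <-] := quotient_map_surj v.
  exists (fun i => h i x); rewrite (eq_bigr (fun i : 'I_n =>
    quotient_map W (S (h i x *: y i)))); last by move=> i _; rewrite !linearZ.
  rewrite -!linear_sum; apply/quotient_map_eq/WP => j jn.
  exact: (@dual_proj_ker _ _ _ S n h y).
have LW : subspace_set L `<=` subspace_set W.
  move=> x /qnorm_eq0 Lx; apply/WP => j /hq[B _ /(_ x)].
  by rewrite Lx mulr0 normr_le0 => /eqP.
have e2 : 0 < e / 2 by rewrite divr_gt0.
have [u [Wu Lu] Tu] := TL Wfin LW e2.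
have qu : 0 < q u.
  rewrite lt_neqAle eq_sym qnorm_ge0 andbT; apply/eqP => /qnorm_eq0; exact: Lu.
have [B B0 HB] := @dual_comb_bound _ _ _ L n h y hq.
pose C := 1 + M * B; have C0 : 0 < C by rewrite ltr_pwDl// mulr_ge0.
(* Chosen so that [(N + e + 1) * (C * d) = e / 2 * q u]: [N] pays for [T v], [e] for the loss from
   [q u] to [q v], and [1] makes the inequality strict. *)
pose d := e * q u / (2 * (C * (N + e + 1))).
have d0 : 0 < d by rewrite divr_gt0 ?mulr_gt0// ltr_wpDl// addr_ge0// ltW.
have [w uw] := Sdense u d0.
exists (w - dual_comb n h y (S w)); rewrite -dual_proj_range.
set v := dual_proj _ _ _ _ _.
split; first by move=> j jn; exact: dual_proj_ker.
have uE : dual_proj S n h y u = u.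
  rewrite /dual_proj /dual_comb big1 ?linear0 ?addr0 ?subr0// => i _.
  by rewrite (WP u).1// scale0r.
have uv : `|u - v| <= C * d.
  have -> : u - v = (u - S w) - S (dual_comb n h y (u - S w)).
    rewrite -[u in LHS]uE /v /dual_proj.
    have -> : dual_comb n h y (u - S w) = dual_comb n h y u - dual_comb n h y (S w).
      rewrite /dual_comb -sumrB; apply: eq_bigr => i _.
      by rewrite raddfB scalerBl.
    by rewrite [S (_ - _)]linearB/= [in LHS]opprD addrACA -opprD.
  rewrite (le_trans (ler_normB _ _))// /C mulrDl mul1r lerD ?(ltW uw)//.
  rewrite (le_trans (SM _))// -mulrA ler_wpM2l// (le_trans (HB _))// ler_wpM2l//.
  by rewrite (le_trans (qnorm_le _ _))// ltW.
have Cd : (N + e + 1) * (C * d) = e / 2 * q u.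
  by rewrite /d; field; rewrite (gt_eqF C0) gt_eqF// ltr_wpDl// addr_ge0// ltW.
have Tv : `|T v| <= e / 2 * q u + N * (C * d).
  rewrite (_ : v = u - (u - v)); last by rewrite subKr.
  rewrite linearB (le_trans (ler_normB _ _))// lerD// (le_trans (TN _))//.
  by rewrite ler_wpM2l.
have qv : q u <= q v + C * d.
  rewrite -{1}(subrK v u) addrC (le_trans (qnormD _ _ _))// lerD2l.
  exact: le_trans (qnorm_le _ _) uv.
have Cd0 : 0 < C * d by rewrite mulr_gt0.
have := ler_wpM2l (ltW e0) qv; nra.
Qed.

(** Here [b] is the stage bound and [k] the precision relative to [g]. The last clause, failure of
    control by [T] on the kernel, is what later extends dual systems. *)
Lemma step_functional n (h : nat -> {scalar E}) (y : nat -> G)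
    (g : {scalar E}) (k b e : R) :
  (forall j, (j < n)%N -> qbounded L (h j)) ->
  (forall i j, (i < n)%N -> (j < n)%N -> h i (S (y j)) = (i == j)%:R) ->
  qbounded L g -> 0 < k -> 0 < b -> 0 < e ->
  exists (f : {scalar E}) (p : G),
    [/\ qbounded L f, forall w, `|f (S w)| * b <= `|w|,
        [/\ `|S p| <= e, f (S p) = 1 & forall j, (j < n)%N -> h j (S p) = 0],
        exists2 d, 0 < d & forall w, `|f (S w) - d * g (S w)| <= d * k * `|w|
      & forall r, 0 < r -> exists v, [/\ forall j, (j < n)%N -> h j (S v) = 0,
          f (S v) = 1 & `|T (S v)| <= r]].
Proof.
move=> hq hy [B B0 gB] k0 b0 e0.
(* With this [d], the bounds [d * B * M] for [d * g] and [d * k] for the rest add up to [b^-1] on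
   the range. *)
pose d := (b * (B * M + k))^-1.
have BMk : 0 < B * M + k by rewrite ltr_wpDl// mulr_ge0.
have d0 : 0 < d by rewrite invr_gt0 mulr_gt0.
have dk0 : 0 < d * k / 2 by rewrite divr_gt0// mulr_gt0.
have [f0 [p0 [f0q f0S p0e hp0 f0p]]] :=
  small_dominated_functional M0 SM Sdense Sproper SL hq hy dk0 e0.
have [s1 s11 [_ f1p']] := no_cancel_sign (d * g (S p0)) (f0 (S p0)).
have [f1 f1E] := scalar_comb d s1 g f0.
have f1p : 1 <= `|f1 (S p0)|.
  by rewrite f1E (le_trans f0p)// (le_trans (ler_norm _)).
have f1S w : `|f1 (S w) - d * g (S w)| <= d * k / 2 * `|w|.
  by rewrite f1E addrAC subrr add0r normrM s11 mul1r.
have f1q : qbounded L f1.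
  have [B1 B10 f0B] := f0q; exists (d * B + B1).
    by rewrite addr_ge0// mulr_ge0// ltW.
  move=> x; rewrite f1E (le_trans (ler_normD _ _))// mulrDl lerD//.
    by rewrite normrM gtr0_norm// -mulrA ler_wpM2l// ltW.
  by rewrite normrM s11 mul1r.
pose Z := [set x | exists2 p, x = S p & forall j, (j < n)%N -> h j (S p) = 0].
have [f2 [f2q f2p f2S f2T]] : exists f2 : {scalar E}, [/\ qbounded L f2,
    1 <= `|f2 (S p0)|, forall w, `|f2 (S w) - d * g (S w)| <= d * k * `|w|
    & forall C, 0 <= C -> exists2 x, Z x & C * `|T x| < `|f2 x|].
  (* If [T] does not control [f1] on [Z], keep [f1]; otherwise adding a small multiple of an
     uncontrolled [phi] destroys the control. *)
  have [f1T|] := pselect (forall C, 0 <= C -> exists2 x, Z x & C * `|T x| < `|f1 x|).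
    exists f1; split => // w; rewrite (le_trans (f1S _))// ler_wpM2r//.
    by rewrite ler_pdivrMr// ler_peMr ?ler1n// mulr_ge0 ?ltW.
  move=> /existsNP[C0 /not_implyP[C00 f1C]].
  have {}f1C x : Z x -> `|f1 x| <= C0 * `|T x|.
    by move=> Zx; rewrite leNgt; apply/negP => lt; apply: f1C; exists x.
  have [phi [phiq phiT]] : exists f : {scalar E}, (forall x, `|f x| <= q x) /\
      forall C, 0 <= C -> exists2 v, Z v & C * `|T v| < `|f v|.
    apply: undominated_functional => //; first exact: qnormD.
    - exact: qnormZ.
    - move=> r r0; have [p [hp pr]] := kato_in_range hq hy r0.
      by exists (S p) => //; exists p.
  pose c := d * k / (2 * (M + 1)).
  have M1 : 0 < M + 1 by rewrite ltr_wpDl.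
  have c0 : 0 < c by rewrite divr_gt0 ?mulr_gt0.
  have [s3 s31 [f2p _]] := no_cancel_sign (f1 (S p0)) (c * phi (S p0)).
  have s3c : `|s3 * c| = c by rewrite normrM s31 mul1r gtr0_norm.
  have [f2 f2E] := scalar_comb 1 (s3 * c) f1 phi.
  exists f2; split.
  - have [B1 B10 f1B] := f1q; exists (B1 + c); first by rewrite addr_ge0// ltW.
    move=> x; rewrite f2E mul1r (le_trans (ler_normD _ _))// mulrDl lerD//.
    by rewrite normrM s3c ler_wpM2l ?(ltW c0).
  - by rewrite f2E mul1r -mulrA (le_trans f1p).
  - move=> w; rewrite f2E mul1r addrAC (le_trans (ler_normD _ _))//.
    rewrite [leRHS](_ : _ = d * k / 2 * `|w| + d * k / 2 * `|w|); last by field.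
    rewrite lerD// normrM s3c.
    rewrite (le_trans (ler_wpM2l (ltW c0) (phiq _)))//.
    rewrite (le_trans (ler_wpM2l (ltW c0) (qnorm_le _ _)))//.
    rewrite (le_trans (ler_wpM2l (ltW c0) (SM _)))// mulrA ler_wpM2r//.
    have -> : c * M = d * k / 2 * (M / (M + 1)) by rewrite /c; field; rewrite gt_eqF.
    by rewrite ler_piMr ?(ltW dk0)// ler_pdivrMr// mul1r lerDl.
  (* The summand [C0] absorbs [|f1 x| <= C0 * |T x|]. *)
  - move=> C CC; have [|x Zx xC] := phiT ((C + C0) / c).
      by rewrite divr_ge0 ?addr_ge0// ltW.
    exists x => //; rewrite f2E mul1r.
    move: xC; rewrite mulrAC ltr_pdivrMr// => xC; have f1x := f1C _ Zx.
    have := ler_normB (f1 x + s3 * c * phi x) (f1 x).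
    rewrite [in leLHS]addrAC subrr add0r normrM s3c; lra.
pose al := f2 (S p0).
have al0 : al != 0 by rewrite -normr_gt0 (lt_le_trans _ f2p).
exists f2, (al^-1 *: p0); split => //.
- move=> w; rewrite -ler_pdivlMr// mulrC.
  have -> : b^-1 * `|w| = d * k * `|w| + d * (B * M * `|w|).
    by rewrite /d; field; rewrite !gt_eqF.
  rewrite -(subrK (d * g (S w)) (f2 (S w))) (le_trans (ler_normD _ _))// lerD//.
  rewrite normrM gtr0_norm// ler_wpM2l ?(ltW d0)// (le_trans (gB _))// -mulrA.
  by rewrite ler_wpM2l// (le_trans (qnorm_le _ _)).
- split.
  + rewrite linearZ normrZ normfV ler_pdivrMl ?normr_gt0// (le_trans p0e)//.
    by rewrite ler_peMl// ltW.
  + by rewrite !linearZ/= mulVf.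
  + by move=> j jn; rewrite !linearZ/= hp0// mulr0.
- by exists d.
- move=> r r0; have [|_ [p -> hp] rp] := f2T r^-1; first by rewrite invr_ge0 ltW.
  have fp : 0 < `|f2 (S p)|.
    by rewrite (le_lt_trans _ rp)// mulr_ge0// invr_ge0 ltW.
  exists ((f2 (S p))^-1 *: p); split.
  + by move=> j jn; rewrite !linearZ/= hp// mulr0.
  + by rewrite !linearZ/= mulVf// -normr_gt0.
  + rewrite !linearZ/= normrZ normfV ler_pdivrMl// -ler_pdivrMr// mulrC.
    exact: ltW.
Qed.

End Step.

(** * The sequence of functionals *)

Section Construction.
Variables (R : realType) (E F G : completeNormedModType R).
Variables (L : closedSubspace E) (S : {linear G -> E}) (M : R).
Variables (T : {linear E -> F}) (N : R).
Hypothesis M0 : 0 <= M.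
Hypothesis SM : forall w, `|S w| <= M * `|w|.
Hypothesis N0 : 0 <= N.
Hypothesis TN : forall x, `|T x| <= N * `|x|.
Hypothesis Sdense : forall x e, 0 < e -> exists w, `|x - S w| < e.
Hypothesis Sproper : exists x, forall w, S w <> x.
Hypothesis SL : forall w, subspace_set L (S w) -> S w = 0.
Hypothesis TL : kato_property T L.
Variable g : nat -> {scalar E}.
Hypothesis gq : forall m, qbounded L (g m).
Local Notation q := (qnorm L).

(** Stage [n] approximates a multiple of [g m] with precision [1 / (k + 1)], where
    [code n = (m, k)]; every pair occurs. *)
Definition code (n : nat) : nat * nat := odflt (0, 0)%N (unpickle n).

Lemma pickle_codeK z : code (pickle z) = z.
Proof. by rewrite /code pickleK. Qed.

(* [stage_fun] takes the value [1] at [S stage_vec]; [stage_dual] is a system dual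
   to the functionals of the earlier stages; [stage_bound] is a bound on the
   preimages under [S] met so far, and [stage_fun] is small relative to it. *)
Record stage := Stage {
  stage_fun : {scalar E} ; stage_vec : G ; stage_dual : nat -> G ; stage_bound : R }.

Definition dual_to (n : nat) (h : nat -> {scalar E}) (y : nat -> G) (e : R) :=
  (forall i j, (i < n)%N -> (j < n)%N -> h i (S (y j)) = (i == j)%:R) /\
  forall j, (j < n)%N -> `|T (S (y j))| <= e.

(** The factor [n.+1%:R] in the first clause lets a sum over the [n] dual vectors stay below
    [2^-1 ^+ n]. *)
Definition next_stage (n : nat) (s : nat -> stage) (x : stage) : Prop :=
  [/\ dual_to n (stage_fun \o s) (stage_dual x) (2^-1 ^+ n / n.+1%:R),
      1 + \sum_(j < n) `|stage_dual x j| <= stage_bound x /\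
        forall m, (m < n)%N -> stage_bound (s m) + `|stage_vec (s m)| <= stage_bound x,
      qbounded L (stage_fun x) /\ forall w, `|stage_fun x (S w)| * stage_bound x <= `|w|,
      [/\ `|S (stage_vec x)| <= 2^-1 ^+ n, stage_fun x (S (stage_vec x)) = 1
        & forall j, (j < n)%N -> stage_fun (s j) (S (stage_vec x)) = 0]
    & exists2 d, 0 < d & forall w,
        `|stage_fun x (S w) - d * g (code n).1 (S w)| <= d * (code n).2.+1%:R^-1 * `|w|].

Lemma next_stage_ext n s s' x : (forall j, (j < n)%N -> s j = s' j) ->
  next_stage n s x -> next_stage n s' x.
Proof.
move=> ss' [[d1 d2] [b1 b2] hx [u1 u2 u3] hd]; split => //.
- by split => // i j ni nj; rewrite /= -ss'// d1.
- by split => // m mn; rewrite -ss'// b2.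
- by split => // j nj; rewrite -ss'// u3.
Qed.

(** The invariant [P] asks for dual systems on which [T] is arbitrarily small, so that each stage
    can pick one before its own functional is built. *)
Lemma stages : exists s : nat -> stage, forall n, next_stage n s (s n).
Proof.
pose x0 := Stage (g 0%N) 0 (fun=> 0) 0.
pose P (s : seq stage) :=
  (forall j, (j < size s)%N -> qbounded L (stage_fun (nth x0 s j))) /\
  forall e, 0 < e -> exists y, dual_to (size s) (stage_fun \o nth x0 s) y e.
pose Q (s : seq stage) x := next_stage (size s) (nth x0 s) x.
have P0 : P [::] by split => // e e0; exists (fun=> 0); split.
have [|s sP] := @history_choice _ P Q P0; last first.
  exists s => n; have [_] := sP n; rewrite /Q size_mkseq.
  by apply: next_stage_ext => j jn; rewrite nth_mkseq.
move=> s [hq hd]; set n := size s in hq hd.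
pose h := stage_fun \o nth x0 s.
have e0 : 0 < 2^-1 ^+ n / n.+1%:R :> R.
  by rewrite divr_gt0// exprn_gt0// invr_gt0.
have [y yP] := hd _ e0.
pose bs := 1 + \sum_(j < n) `|y j| +
  \sum_(m < n) `|stage_bound (nth x0 s m) + `|stage_vec (nth x0 s m)| |.
have bs1 : 1 + \sum_(j < n) `|y j| <= bs by rewrite lerDl sumr_ge0.
have bs0 : 0 < bs by rewrite (lt_le_trans _ bs1)// ltr_pwDl// sumr_ge0.
have k0 : 0 < (code n).2.+1%:R^-1 :> R by rewrite invr_gt0.
have e1 : 0 < 2^-1 ^+ n :> R by rewrite exprn_gt0// invr_gt0.
have [f [p [fq fS fp fd fT]]] :=
  step_functional M0 SM N0 TN Sdense Sproper SL TL hq yP.1 (gq (code n).1) k0 bs0 e1.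
exists (Stage f p y bs); split; last first.
  split => //; split => // m mn; rewrite (le_trans (ler_norm _))//.
  rewrite /bs [X in _ <= _ + X](bigD1 (Ordinal mn))//= [leRHS]addrCA lerDl addr_ge0 ?sumr_ge0//.
  by rewrite addr_ge0// sumr_ge0.
have hn j : (j < n)%N -> nth x0 (rcons s (Stage f p y bs)) j = nth x0 s j.
  by move=> jn; rewrite nth_rcons jn.
have hn' : nth x0 (rcons s (Stage f p y bs)) n = Stage f p y bs.
  by rewrite nth_rcons ltnn eqxx.
split; rewrite size_rcons -/n.
  move=> j; rewrite ltnS leq_eqVlt => /orP[/eqP->|jn]; first by rewrite hn'.
  by rewrite hn//; exact: hq.
move=> e e2; have e3 : 0 < e / 2 by rewrite divr_gt0.
have [z [zd zT]] := hd _ e3.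
pose K := 1 + \sum_(j < n) `|f (S (z j))|.
have K1 : 1 <= K by rewrite lerDl sumr_ge0.
have K0 : 0 < K by rewrite (lt_le_trans _ K1).
have [v [hv fv Tv]] := fT _ (divr_gt0 e3 K0).
(* Only [f] sees [v] among the functionals, so this subtraction kills [f] at the old dual vectors;
   [K] bounds the coefficients. *)
exists (fun j => if (j < n)%N then z j - f (S (z j)) *: v else v); split.
  move=> i j; rewrite !ltnS => ni nj /=.
  move: ni; rewrite leq_eqVlt => /orP[/eqP->|ni].
    rewrite hn'/=; case: ifPn => jn.
      rewrite [S _]linearB [f _]linearB/= [S (_ *: _)]linearZ/= [f (_ *: _)]linearZ/=.
      by rewrite fv mulr1 subrr gtn_eqF.
    by rewrite fv; have -> : j = n; [apply/eqP; rewrite eqn_leq nj leqNgt|rewrite eqxx].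
  rewrite hn//; case: ifPn => jn.
    rewrite [S _]linearB raddfB/= [S (_ *: _)]linearZ/= linearZ/=.
    by rewrite hv// mulr0 subr0; exact: zd.
  by rewrite hv//; have -> : j = n; [apply/eqP; rewrite eqn_leq nj leqNgt|rewrite ltn_eqF].
move=> j _; case: ifPn => jn; last first.
  rewrite (le_trans Tv)// ler_pdivrMr// (le_trans (_ : _ <= e))//; first lra.
  by rewrite ler_peMr// ltW.
rewrite [S _]linearB [T _]linearB/= (le_trans (ler_normB _ _))//.
rewrite [leRHS]splitr lerD ?zT// !linearZ/= normrZ.
rewrite (le_trans (ler_wpM2l (normr_ge0 _) Tv))// mulrCA ler_piMr ?(ltW e3)//.
rewrite ler_pdivrMr// mul1r /K (bigD1 (Ordinal jn))//= addrCA lerDl.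
by rewrite addr_ge0// sumr_ge0.
Qed.

(** * Approximating vectors of the range modulo the common kernel *)

Section Approximation.
Variable s : nat -> stage.
Hypothesis sP : forall n, next_stage n s (s n).
Local Notation h n := (stage_fun (s n)).
Local Notation y n := (stage_dual (s n)).

Lemma stage_bound_ge1 n : 1 <= stage_bound (s n).
Proof.
by have [_ [b1 _] _ _ _] := sP n; rewrite (le_trans _ b1)// lerDl sumr_ge0.
Qed.

Lemma stage_fun_le n w : `|h n (S w)| <= `|w|.
Proof.
have [_ _ [_ /(_ w) hb] _ _] := sP n.
by rewrite (le_trans _ hb)// ler_peMr// stage_bound_ge1.
Qed.

(* [x] is corrected first by a vector on which [T] is small, then successively by
   the vectors [stage_vec]; the bounds [stage_bound] keep the coefficients bounded by [`|w|]. *)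
Lemma range_approximation w n : exists e,
  [/\ forall j, h j e = 0,
      `|T (S (\sum_(j < n) h j (S w) *: y n j))| <= 2^-1 ^+ n * `|w|
    & `|S w - S (\sum_(j < n) h j (S w) *: y n j) - e| <= 2 * `|w| * 2^-1 ^+ n].
Proof.
set c := \sum_(j < n) _.
(* [S (W k)] is killed by the first [n + k] functionals, and [W k] stays within
   [stage_bound (s (n + k)) * |w|], which keeps the next coefficient at most [|w|]. *)
pose W := fix W k := if k is k'.+1 then
  W k' - h (n + k')%N (S (W k')) *: stage_vec (s (n + k')%N) else w - c.
have [[yd yT] [yb _] _ _ _] := sP n.
have Wb k : `|W k| <= stage_bound (s (n + k)%N) * `|w|.
  elim: k => [|k ih] /=.
    rewrite addn0 (le_trans (ler_normB _ _))//.
    apply: le_trans (ler_wpM2r (normr_ge0 w) yb).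
    rewrite mulrDl mul1r lerD2l (le_trans (ler_norm_sum _ _ _))//.
    rewrite mulr_suml ler_sum// => j _.
    by rewrite normrZ mulrC ler_wpM2l// stage_fun_le.
  have [_ [_ bb] _ _ _] := sP (n + k.+1)%N.
  have {bb} := bb (n + k)%N; rewrite addnS ltnS leqnn => /(_ isT) bb.
  apply: le_trans (ler_wpM2r (normr_ge0 w) bb).
  rewrite (le_trans (ler_normB _ _))// mulrDl lerD// normrZ mulrC ler_wpM2l//.
  have [_ _ [_ /(_ (W k)) hb] _ _] := sP (n + k)%N.
  have b0 : 0 < stage_bound (s (n + k)%N) by rewrite (lt_le_trans _ (stage_bound_ge1 _)).
  by rewrite -(ler_pM2r b0) (le_trans hb)// mulrC.
have Wh k : `|h (n + k)%N (S (W k))| <= `|w|.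
  have [_ _ [_ /(_ (W k)) hb] _ _] := sP (n + k)%N.
  have b0 : 0 < stage_bound (s (n + k)%N) by rewrite (lt_le_trans _ (stage_bound_ge1 _)).
  by rewrite -(ler_pM2r b0) (le_trans hb)// mulrC.
have zS k : `|S (W k.+1) - S (W k)| <= `|w| * 2^-1 ^+ n * 2^-1 ^+ k.
  rewrite /= [S (_ - _)]linearB/= addrAC subrr add0r normrN linearZ/= normrZ.
  have [_ _ _ [u1 _ _] _] := sP (n + k)%N.
  by rewrite -mulrA ler_pM// -exprD.
have zh k j : (j < n + k)%N -> h j (S (W k)) = 0.
  elim: k => [|k ih] /=; first rewrite addn0 => jn.
    rewrite [S _]linearB raddfB/=.
    rewrite (_ : h j (S c) = h j (S w)) ?subrr//.
    exact: (functional_dual_comb (h := fun i => h i) yd).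
  have [_ _ _ [_ u2 u3] _] := sP (n + k)%N.
  rewrite addnS ltnS leq_eqVlt [S _]linearB [_ (_ - _)]raddfB/= [S (_ *: _)]linearZ/= [stage_fun _ (_ *: _)]linearZ/=.
  move=> /orP[/eqP->|jn]; first by rewrite u2 mulr1 subrr.
  by rewrite ih// u3// mulr0 subr0.
have [e eP] := geometric_limit zS.
exists e; split.
- move=> j; have [_ _ [[B B0 hB] _] _ _] := sP j.
  apply/eqP; rewrite -normr_le0; apply/ler_addgt0Pr => r r0; rewrite add0r.
  have [K HK] := half_expr_small (B * (2 * (`|w| * 2^-1 ^+ n))) r0.
  (* Large enough for smallness and for [h j] to vanish at [S (W k)]. *)
  pose k := (K + j.+1)%N.
  rewrite (_ : h j e = h j (e - S (W k))); last first.
    by rewrite raddfB/= zh ?subr0// /k !addnS ltnS addnA leq_addl.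
  rewrite (le_trans _ (ltW (HK k _))) ?leq_addr//.
  rewrite (le_trans (hB _))// -mulrA ler_wpM2l// (le_trans (qnorm_le _ _))//.
- rewrite !linear_sum (le_trans (ler_norm_sum _ _ _))//.
  have n1 : 0 < n.+1%:R :> R by [].
  have -> : 2^-1 ^+ n * `|w| = \sum_(j < n.+1) (2^-1 ^+ n / n.+1%:R * `|w|) :> R.
    by rewrite sumr_const card_ord -mulr_natr; field; rewrite gt_eqF.
  rewrite big_ord_recr/= -[leLHS]addr0; apply: lerD; last first.
    by rewrite mulr_ge0// divr_ge0// exprn_ge0// invr_ge0.
  rewrite ler_sum// => j _; rewrite !linearZ/= normrZ mulrC ler_pM ?yT//.
  exact: stage_fun_le.
- rewrite -linearB distrC; have := eP 0%N; rewrite expr0 mulr1 => /le_trans; apply.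
  by rewrite mulrA.
Qed.

End Approximation.

End Construction.

(** * Weak* separability and the theorem *)

Section SeparatingSequence.
Variables (R : realType) (V : normedModType R).

(** If [x] is nonzero, the functionals nonzero at [x] form a weak* open set, nonempty by
    Hahn-Banach, so [D] meets it. *)
Lemma weak_star_separating (D : set (set_type (weak_star_dual V))) (x : V) :
  dense D -> (forall f, D f -> (val f : V -> R) x = 0) -> x = 0.
Proof.
move=> dD Dx; apply/eqP/negP => /negP x0.
have [f [fx fle]] := seminorm_Hahn_Banach (@ler_normD _ V) (@normrZ _ V) x.
have fw : weak_star_dual V (f : {ptws V -> R^o}).
  split; last by exists 1 => y; rewrite mul1r; exact: fle.
  by move=> a u v; exact: linearP.
pose ev (phi : set_type (weak_star_dual V)) : R^o := @proj V (fun=> R^o) x (set_val phi).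
have Oo : open (ev @^-1` [set r | r != 0]).
  exists (@proj V (fun=> R^o) x @^-1` [set r | r != 0]) => //.
  apply: open_comp; last exact: (@open_neq R 0).
  by move=> ? _; exact: (@proj_continuous V (fun=> R^o)).
have [|phi [phi0 Dphi]] := dD _ _ Oo.
  exists (exist (fun u => u \in weak_star_dual V) (f : {ptws V -> R^o}) (mem_set fw)).
  by rewrite /ev/proj/= set_valE/= fx normr_eq0.
by move: phi0 => /eqP; apply; exact: Dx.
Qed.

Lemma separating_sequence : separable_space (set_type (weak_star_dual V)) ->
  exists g : nat -> {scalar V},
    (forall m, exists2 B : R, 0 <= B & forall x, `|g m x| <= B * `|x|) /\
    forall x, (forall m, g m x = 0) -> x = 0.
Proof.
move=> [D /countable_injP[c cinj] dD].
have /choice[g gP] m : exists g : {scalar V},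
    (exists2 B : R, 0 <= B & forall x, `|g x| <= B * `|x|) /\
    forall f, D f -> c f = m -> forall x, g x = (val f : V -> R) x.
  have [[f [Df fm]]|nf] := pselect (exists f, D f /\ c f = m).
    have [flin [B fB]] := set_valP f.
    have [g gE] : exists g : {scalar V}, forall x, g x = (val f : V -> R) x.
      by apply: scalar_of => a x y; exact: flin.
    exists g; split.
      by exists `|B| => // x; rewrite gE (le_trans (fB x))// ler_wpM2r// ler_norm.
    move=> f' Df' f'm x; rewrite gE.
    by have -> : f' = f by apply: cinj; rewrite ?inE// fm f'm.
  (* Indices that code no element of [D] get the zero functional. *)
  have [g gE] : exists g : {scalar V}, forall x, g x = 0.
    by apply: scalar_of => a x y; rewrite mulr0 addr0.
  exists g; split; first by exists 0 => // x; rewrite gE normr0 mul0r.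
  by move=> f Df fm; case: nf; exists f.
exists g; split => [m|x gx]; first exact: (gP m).1.
apply: (weak_star_separating dD) => f Df.
by rewrite -((gP (c f)).2 f)// gx.
Qed.

End SeparatingSequence.

Lemma quotient_separating_sequence (R : realType) (E : normedModType R)
    (L : closedSubspace E) :
  separable_space (set_type (weak_star_dual (quotient_space L))) ->
  exists g : nat -> {scalar E}, (forall m, qbounded L (g m)) /\
    forall x, (forall m, g m x = 0) -> subspace_set L x.
Proof.
move=> /separating_sequence[g [gB gs]].
have /choice[f fE] m : exists f : {scalar E}, forall x, f x = g m (quotient_map L x).
  by apply: scalar_of => a x y; rewrite quotient_map_linear linearP.
exists f; split => [m|x fx].
  by have [B B0 gb] := gB m; exists B => // x; rewrite fE gb.
apply/qnorm_eq0; rewrite /qnorm (gs (quotient_map L x)) ?normr0// => m.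
by rewrite -fE.
Qed.

Lemma dense_near (R : realType) (E : normedModType R) (D : set E) :
  dense D <-> forall x e, 0 < e -> exists2 d, D d & `|x - d| < e.
Proof.
split=> [dD x e e0|dD O [x Ox] Oo].
  have [||d [xd Dd]] := dD (ball x e); [by exists x; exact: ballxx| exact: ball_open|].
  by exists d => //; move: xd; rewrite -ball_normE.
have /nbhs_ballP[e /= e0 xe] : nbhs x O by exact: open_nbhs_nbhs.
have [d Dd xd] := dD x e e0.
by exists d; split => //; apply: xe; rewrite -ball_normE.
Qed.

(** Coefficients form a [seq rat], so that combinations of all lengths are indexed by one countable
    type. *)
Lemma rational_approximation (R : realType) (E : normedModType R) n
    (a : 'I_n -> R) (v : 'I_n -> E) e : 0 < e ->
  exists c : seq rat,
    `|\sum_(j < n) a j *: v j - \sum_(j < n) (ratr c`_j : R) *: v j| < e.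
Proof.
move=> e0; pose K := 1 + \sum_(j < n) `|v j|.
have K0 : 0 < K by rewrite ltr_pwDl// sumr_ge0.
have /choice[r rP] (j : 'I_n) : exists r : rat, `|a j - ratr r| < e / K.
  have d0 : 0 < e / K by rewrite divr_gt0.
  have [|r] := @rat_in_itvoo _ (a j) (a j + e / K); first by rewrite ltrDl.
  rewrite in_itv/= => /andP[r1 r2]; exists r.
  by rewrite ler0_norm ?subr_le0 ?ltW//; lra.
exists (mkseq (fun j => if insub j is Some i then r i else 0) n).
rewrite -sumrB (le_lt_trans (ler_norm_sum _ _ _))//.
apply: (@le_lt_trans _ _ (\sum_(j < n) e / K * `|v j|)).
  apply: ler_sum => j _; rewrite -scalerBl normrZ ler_wpM2r//.
  by rewrite nth_mkseq//= valK ltW.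
by rewrite -mulr_sumr mulrAC ltr_pdivrMr// ltr_pM2l// /K ltrDr.
Qed.

Theorem theorem4p1 (R : realType) (E F : completeNormedModType R)
    (L : closedSubspace E) (T : {linear E -> F}) (A : set E) :
  ~ finite_codimensional L ->
  bounded_operator T ->
  kato_property T L ->
  proper_dense_operator_range A ->
  A `&` L = [set 0] ->
  separable_space (set_type (weak_star_dual (quotient_space L))) ->
  exists E1 : closedSubspace E,
    [/\ L `<=` E1,
        separable_space (quotient_space E1) /\ ~ finite_codimensional E1,
        E1 `&` A = [set 0]
      & closure (T @` E1) = closure (range T)].
Proof.
move=> _ [N' TN'] TL [[G [S [[M' SM'] SA]]] Ad AT] AL /quotient_separating_sequence[g [gq gL]].
pose N : R := `|N'|; have N0 : 0 <= N by exact: normr_ge0.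
have TN x : `|T x| <= N * `|x|.
  by rewrite (le_trans (TN' _))// ler_wpM2r// ler_norm.
pose M : R := `|M'|; have M0 : 0 <= M by exact: normr_ge0.
have SM w : `|S w| <= M * `|w|.
  by rewrite (le_trans (SM' _))// ler_wpM2r// ler_norm.
have Sdense x e : 0 < e -> exists w, `|x - S w| < e.
  move: Ad; rewrite -SA => /dense_near/(_ x e)/[apply] -[_ [w _ <-]].
  by exists w.
have Sproper : exists x, forall w, S w <> x.
  apply: contrapT => nS; apply: AT; rewrite -SA -subTset => x _.
  by apply: contrapT => nx; apply: nS; exists x => w Sw; apply: nx; exists w.
have SL w : subspace_set L (S w) -> S w = 0.
  by move=> Lw; have : (A `&` L) (S w) by [rewrite -SA; split => //; exists w]; rewrite AL.
have [s sP] := stages M0 SM N0 TN Sdense Sproper SL TL gq.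
pose h n := stage_fun (s n); pose y n := stage_dual (s n).
have hq n : qbounded L (h n) by have [_ _ []] := sP n.
have [E1 E1P] := @kernel_closedSubspace _ _ L (fun=> True) h (fun j _ => hq j).
have approx w n : exists e, [/\ subspace_set E1 e,
      `|T (S (\sum_(j < n) h j (S w) *: y n j))| <= 2^-1 ^+ n * `|w|
    & `|S w - S (\sum_(j < n) h j (S w) *: y n j) - e| <= 2 * `|w| * 2^-1 ^+ n].
  have [e [he Te xe]] := range_approximation sP w n.
  by exists e; split => //; apply/E1P => j _; exact: he.
exists E1; split.
- by move=> x /qnorm_eq0 Lx; apply/E1P => j _; have [B _ /(_ x)] := hq j;
    rewrite Lx mulr0 normr_le0 => /eqP.
- split.
    pose d (z : nat * seq rat) := quotient_map E1
      (S (\sum_(j < z.1) (ratr z.2`_j : R) *: y z.1 j)).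
    exists (range d).
      by apply: sub_countable (card_image_le _ _) _; exact: countableP.
    apply/dense_near => Y e e0; have [x <-] := quotient_map_surj Y.
    have e4 : 0 < e / 4 by rewrite divr_gt0.
    have [w xw] := Sdense x _ e4.
    have [n hn] := half_expr_small (2 * `|w|) e4.
    have [e1 [E1e _ we1]] := approx w n.
    have [c cP] := rational_approximation (fun j : 'I_n => h j (S w))
      (fun j => S (y n j)) e4.
    exists (d (n, c)); first by exists (n, c).
    rewrite /d -raddfB/= -[X in quotient_map _ X](subrK e1).
    rewrite quotient_mapD (_ : quotient_map E1 e1 = 0) ?addr0; last first.
      by rewrite -(quotient_map0 E1); apply/quotient_map_eq; rewrite subr0.
    rewrite (le_lt_trans (qnorm_le _ _))//.
    set b := \sum_(j < n) _; set a := S (\sum_(j < n) h j (S w) *: y n j) in we1.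
    have ab : `|a - S b| < e / 4.
      have -> : a = \sum_(j < n) h j (S w) *: S (y n j).
        by rewrite /a linear_sum; apply: eq_bigr => j _; rewrite linearZ.
      have -> : S b = \sum_(j < n) (ratr c`_j : R) *: S (y n j).
        by rewrite /b linear_sum; apply: eq_bigr => j _; rewrite linearZ.
      exact: cP.
    rewrite (_ : x - S b - e1 = (x - S w) + (S w - a - e1) + (a - S b)); last first.
      by rewrite -[S w - a - e1]addrA subrKA [x + (_ + _)]addrA [in RHS]addrAC subrKA addrAC.
    have we2 := le_lt_trans we1 (hn _ (leqnn n)).
    rewrite (le_lt_trans (ler_normD _ _))// (le_lt_trans (lerD (ler_normD _ _) (lexx _)))//.
    by lra.
  (* If [n] classes spanned [E / E1], the [n + 1] vectors dual to [h 0, ..., h n] would factor the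
     identity matrix of size [n + 1] through dimension [n]. *)
  move=> [n [b bP]].
  have /choice[B BE] i : exists v, quotient_map E1 v = b i by exact: quotient_map_surj.
  have /choice[c cP] i : exists c : 'I_n -> R,
      quotient_map E1 (S (y n.+1 i)) = \sum_(k < n) c k *: b k by exact: bP.
  have [[yd _] _ _ _ _] := sP n.+1.
  pose C := \matrix_(i < n.+1, k < n) c i k.
  pose H := \matrix_(k < n, j < n.+1) h j (B k).
  suff /mulmx1_min : C *m H = 1%:M by rewrite ltnn.
  apply/matrixP => i j; rewrite !mxE.
  have <- : h j (S (y n.+1 i)) = (i == j)%:R by rewrite [LHS]yd//= eq_sym.
  have : subspace_set E1 (S (y n.+1 i) - \sum_(k < n) c i k *: B k).
    apply/quotient_map_eq; rewrite cP linear_sum; apply: eq_bigr => k _.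
    by rewrite linearZ/= BE.
  move=> /E1P/(_ j I); rewrite linearB/= => /eqP; rewrite subr_eq0 => /eqP ->.
  rewrite linear_sum; apply: eq_bigr => k _.
  by rewrite !mxE linearZ.
- apply/seteqP; split => [x [E1x]|_ ->]; last first.
    by split; [exact: subspace0|rewrite -SA; exists 0 => //; rewrite linear0].
  rewrite -SA => -[w _ Sw]; move: E1x; rewrite -Sw => /E1P hw; apply: SL.
  apply: gL => m; apply/eqP; rewrite -normr_le0.
  apply/ler_addgt0Pr => e e0; rewrite add0r.
  pose k := Num.bound (`|w| / e).
  (* At the stage coding [(m, k)], vanishing of the functional at [S w] leaves
     [|g m (S w)| <= |w| / (k + 1)]. *)
  have [_ _ _ _ [d d0 /(_ w)]] := sP (pickle (m, k)).
  rewrite pickle_codeK/= [stage_fun _ _]hw// sub0r normrN normrM gtr0_norm//.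
  rewrite -mulrA ler_pM2l// => /le_trans; apply.
  rewrite mulrC ler_pdivrMr// -ler_pdivrMl// mulrC (le_trans (ltW (archi_boundP _)))//.
    by rewrite divr_ge0// ltW.
  by rewrite ler_nat.
- apply/seteqP; split; first by apply: closure_subset => _ [x _ <-]; exists x.
  move=> z zT B /nbhs_ballP[r /= r0 rB].
  have r2 : 0 < r / 2 by rewrite divr_gt0.
  have [_ [[x _ <-]]] := zT _ (nbhsx_ballx z _ r2).
  rewrite -ball_normE /ball_/= => zx.
  have N1 : 0 < N + 1 by rewrite ltr_wpDl.
  have d0 : 0 < r / 8 / (N + 1) by rewrite divr_gt0// divr_gt0.
  have r8 : 0 < r / 8 by rewrite divr_gt0.
  have [w xw] := Sdense x _ d0.
  (* The two summands pay for [T] of the remainder and for [T a]. *)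
  have [n hn] := half_expr_small (N * (2 * `|w|) + `|w|) r8.
  have [e [E1e Ta we]] := approx w n.
  set a := S (\sum_(j < n) h j (S w) *: y n j) in Ta we.
  exists (T e); split; first by exists e.
  apply: rB; rewrite -ball_normE /ball_/=.
  have xE : x - e = (x - S w) + (S w - a - e) + a.
    by rewrite -[S w - a - e]addrA subrKA [x + (_ + _)]addrA addrAC subrK.
  have -> : z - T e = (z - T x) + (T (x - S w) + T (S w - a - e) + T a).
    by rewrite -2!linearD -xE linearB/= addrA subrK.
  have h1 : `|T (x - S w)| <= r / 8.
    rewrite (le_trans (TN _))// (le_trans (ler_wpM2l N0 (ltW xw)))//.
    by rewrite mulrCA ler_piMr ?(ltW r8)// ler_pdivrMr// mul1r lerDl.
  have h2 : `|T (S w - a - e)| + `|T a| <= r / 8.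
    rewrite (le_trans _ (ltW (hn _ (leqnn n))))// mulrDl lerD//.
      by rewrite (le_trans (TN _))// -mulrA ler_wpM2l.
    by rewrite mulrC.
  have h3 := ler_normD (T (x - S w) + T (S w - a - e)) (T a).
  have h4 := ler_normD (T (x - S w)) (T (S w - a - e)).
  by rewrite (le_lt_trans (ler_normD _ _))//; lra.
Qed.
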